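(* Let $\mathcal{V}$ be a variety of groups defined by a set of laws $V$. Let $G\cong F/R$ be a free presentation of a group $G$ and let $N\cong S/R$ be a normal subgroup of $G$ which has a complement in $G$. Then $$\mathcal{V}M(G,N)\cong \frac{R\cap[SV^*F]}{[RV^*F]}.$$
   Context: A pair of groups $(G,N)$ is a group $G$ with a normal subgroup $N$. $V(G)$ denotes the verbal subgroup of $G$ determined by $V$. For a normal subgroup $N$ of a group $G$, $[NV^*G]$ is the subgroup of $G$ generated by all elements $v(g_1,\ldots,g_{i}n,\ldots,g_r)\,v(g_1,\ldots,g_r)^{-1}$ with $v\in V$ an $r$-variable law, $1\le i\le r$, $g_1,\ldots,g_r\in G$, $n\in N$. In the free presentation, $F$ is a free group, $R$ is a normal subgroup of $F$, and $S$ is the normal subgroup of $F$ containing $R$ that corresponds to $N$. A free simplicial resolution of a group $G$ is a free simplicial group $K_.$ (each $K_n$ is a free group and the degeneracies send the free basis of $K_n$ into the free basis of $K_{n+1}$), constructed functorially in $G$, with $\pi_0(K_.)\cong G$ and $\pi_m(K_.)=0$ for $m\ge 1$. For a simplicial group $K_.$, $K_./V(K_.)$ is formed dimensionwise. Given a pair $(G,N)$, let $K_.$ and $L_.$ be free simplicial resolutions of $G$ and $G/N$; the natural epimorphism $G\to G/N$ induces an epimorphism of simplicial groups $\alpha:K_.\to L_.$, and hence an epimorphism $\frac{\alpha}{V(\alpha)}:\frac{K_.}{V(K_.)}\to\frac{L_.}{V(L_.)}$. The Baer invariant of the pair $(G,N)$ with respect to $\mathcal{V}$ is $\mathcal{V}M(G,N)=\pi_1\big(\ker\frac{\alpha}{V(\alpha)}\big)$,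 the kernel being taken dimensionwise. *)

(* Defs.v *)
From HB Require Import structures.
From mathcomp Require Import all_boot boolp classical_sets.

Set Implicit Arguments.
Unset Strict Implicit.
Unset Printing Implicit Defensive.

Local Open Scope quotient_scope.
Local Open Scope group_scope.

(* Groups are the (possibly infinite) [groupType]s; subgroups of [G] are the
   [groupClosed] predicates on [G]; homomorphisms are [{multiplicative G -> H}].
   Predicates built from existential or universal statements are reflected to
   bool classically. *)

HB.mixin Record isConjClosed (G : groupType) (S : {pred G}) := {
  gpredJg : forall x g : G, x \in S -> x ^ g \in S
}.

#[short(type="normalClosed")]
HB.structure Definition NormalClosed (G : groupType) :=
  {S of isConjClosed G S & GroupClosed G S}.

Section Morphisms.
Variables (G H : groupType) (f : {multiplicative G -> H}).

Lemma hom1 : f 1 = 1.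
Proof. by apply: (mulgI (f 1)); rewrite -gmulfM !mulg1. Qed.

Lemma homV x : f x^-1 = (f x)^-1.
Proof. by apply: (mulgI (f x)); rewrite -gmulfM !mulgV hom1. Qed.

Lemma homJ x y : f (x ^ y) = f x ^ f y.
Proof. by rewrite /conjg !gmulfM homV. Qed.

Definition kerg : {pred G} := [pred x | f x == 1].

Fact kerg_mul_closed : mulg_closed kerg.
Proof. by move=> x y /eqP fx /eqP fy; rewrite inE gmulfM fx fy mulg1. Qed.
Fact kerg_one_closed : 1 \in kerg.
Proof. by rewrite inE hom1. Qed.
Fact kerg_inv_closed : invg_closed kerg.
Proof. by move=> x /eqP fx; rewrite inE homV fx invg1. Qed.
Fact kerg_conj_closed x g : x \in kerg -> x ^ g \in kerg.
Proof. by move=> /eqP fx; rewrite inE homJ fx conj1g. Qed.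

HB.instance Definition _ := isMulClosed.Build G kerg kerg_mul_closed.
HB.instance Definition _ := isMul1Closed.Build G kerg kerg_one_closed.
HB.instance Definition _ := isInvClosed.Build G kerg kerg_inv_closed.
HB.instance Definition _ := isConjClosed.Build G kerg kerg_conj_closed.

Definition preimg (M : {pred H}) : {pred G} := [pred x | f x \in M].

Section PreimGroup.
Variable M : groupClosed H.
Fact preimg_mul_closed : mulg_closed (preimg M).
Proof. by move=> x y; rewrite !inE gmulfM; apply: gpredM. Qed.
Fact preimg_one_closed : 1 \in preimg M.
Proof. by rewrite inE hom1 gpred1. Qed.
Fact preimg_inv_closed : invg_closed (preimg M).
Proof. by move=> x; rewrite !inE homV; apply: gpredVr. Qed.
HB.instance Definition _ := isMulClosed.Build G (preimg M) preimg_mul_closed.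
HB.instance Definition _ := isMul1Closed.Build G (preimg M) preimg_one_closed.
HB.instance Definition _ := isInvClosed.Build G (preimg M) preimg_inv_closed.
End PreimGroup.

Fact preimg_conj_closed (M : normalClosed H) x g :
  x \in preimg M -> x ^ g \in preimg M.
Proof. by rewrite !inE homJ; apply: gpredJg. Qed.
HB.instance Definition _ (M : normalClosed H) :=
  isConjClosed.Build G (preimg M) (@preimg_conj_closed M).
End Morphisms.

Definition isomorphic (G H : groupType) : Prop :=
  exists f : {multiplicative G -> H}, bijective f.

Section Subgroups.
Variable G : groupType.

Definition capg (A B : {pred G}) : {pred G} := [predI A & B].

Section CapGroup.
Variables A B : groupClosed G.
Fact capg_mul_closed : mulg_closed (capg A B).
Proof.
by move=> x y; rewrite !inE => /andP[? ?] /andP[? ?]; rewrite !gpredM.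
Qed.
Fact capg_one_closed : 1 \in capg A B.
Proof. by rewrite !inE !gpred1. Qed.
Fact capg_inv_closed : invg_closed (capg A B).
Proof. by move=> x; rewrite !inE => /andP[? ?]; rewrite !gpredVr. Qed.
HB.instance Definition _ := isMulClosed.Build G (capg A B) capg_mul_closed.
HB.instance Definition _ := isMul1Closed.Build G (capg A B) capg_one_closed.
HB.instance Definition _ := isInvClosed.Build G (capg A B) capg_inv_closed.
End CapGroup.

Definition generated (A : set G) : {pred G} :=
  [pred x | `[< forall S : groupClosed G,
                  (forall y, A y -> y \in S) -> x \in S >]].

Lemma generatedP (A : set G) x :
  reflect (forall S : groupClosed G, (forall y, A y -> y \in S) -> x \in S)
          (x \in generated A).
Proof. exact: asboolP. Qed.

Section Generated.
Variable A : set G.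
Fact generated_mul_closed : mulg_closed (generated A).
Proof.
move=> x y /generatedP hx /generatedP hy.
by apply/generatedP => S AS; apply: gpredM; [apply: hx | apply: hy].
Qed.
Fact generated_one_closed : 1 \in generated A.
Proof. by apply/generatedP => S _; apply: gpred1. Qed.
Fact generated_inv_closed : invg_closed (generated A).
Proof.
by move=> x /generatedP hx; apply/generatedP => S AS; apply: gpredVr; apply: hx.
Qed.
HB.instance Definition _ := isMulClosed.Build G (generated A) generated_mul_closed.
HB.instance Definition _ := isMul1Closed.Build G (generated A) generated_one_closed.
HB.instance Definition _ := isInvClosed.Build G (generated A) generated_inv_closed.
End Generated.

Lemma mem_generated (A : set G) x : A x -> x \in generated A.
Proof. by move=> Ax; apply/generatedP => S; apply. Qed.

End Subgroups.

Definition conjg_by (G : groupType) (g x : G) : G := x ^ g.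
HB.instance Definition _ (G : groupType) (g : G) :=
  isMultiplicative.Build G G (conjg_by g) (fun x y => conjMg x y g).

Lemma generated_conj (G : groupType) (A : set G) :
  (forall x g, A x -> A (x ^ g)) ->
  forall x g, x \in generated A -> x ^ g \in generated A.
Proof.
move=> AJ x g /generatedP hx.
apply: (hx (preimg (conjg_by g) (generated A))) => y Ay.
by apply: mem_generated; apply: AJ.
Qed.

Definition subg (G : groupType) (S : groupClosed G) := {x : G | x \in S}.

Section Subg.
Variables (G : groupType) (S : groupClosed G).
HB.instance Definition _ := SubChoice.on (subg S).
Fact subg_closed : group_closed (fun x : G => x \in S).
Proof. by split; [apply: gpred1 | move=> x y; apply: gpredF]. Qed.
HB.instance Definition _ :=
  SubChoice_isSubGroup.Build G (fun x => x \in S) (subg S) subg_closed.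

Definition subg_val (u : subg S) : G := val u.
HB.instance Definition _ :=
  isMultiplicative.Build (subg S) G subg_val (fun u v => valM u v).
End Subg.

Section Quotient.
Variables (G : groupType) (N : normalClosed G).

Definition coset_rel (x y : G) : bool := x^-1 * y \in N.

Fact coset_rel_equiv : equiv_class_of coset_rel.
Proof.
split=> [x | x y | y x z]; rewrite /coset_rel.
- by rewrite mulVg gpred1.
- by rewrite -gpredV invgM invgK.
- by move=> xy yz; have := gpredM _ _ xy yz; rewrite -mulgA mulVKg.
Qed.
Canonical coset_equiv_rel := EquivRelPack coset_rel_equiv.

Definition quotg := {eq_quot coset_rel}.
HB.instance Definition _ : EqQuotient G coset_rel quotg := EqQuotient.on quotg.
HB.instance Definition _ := Choice.on quotg.

Definition coset (x : G) : quotg := \pi x.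

Lemma eq_coset x y : coset x = coset y <-> x^-1 * y \in N.
Proof. by split=> [/eqmodP | xy]; last apply/eqmodP. Qed.

Lemma coset_repr (u : quotg) : coset (repr u) = u.
Proof. exact: reprK. Qed.

Definition quotg_mul (u v : quotg) : quotg := coset (repr u * repr v).
Definition quotg_inv (u : quotg) : quotg := coset (repr u)^-1.

Lemma quotg_mulE x y : quotg_mul (coset x) (coset y) = coset (x * y).
Proof.
apply/eq_coset; set x' := repr _; set y' := repr _.
have hx : x'^-1 * x \in N by apply/eq_coset; rewrite coset_repr.
have hy : y'^-1 * y \in N by apply/eq_coset; rewrite coset_repr.
have -> : (x' * y')^-1 * (x * y) = (x'^-1 * x) ^ y' * (y'^-1 * y).
  by rewrite /conjg invgM !mulgA mulgK.
by apply: gpredM hy; apply: gpredJg.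
Qed.

Lemma quotg_invE x : quotg_inv (coset x) = coset x^-1.
Proof.
apply/eq_coset; set x' := repr _.
have hx : x'^-1 * x \in N by apply/eq_coset; rewrite coset_repr.
rewrite invgK; have -> : x' * x^-1 = ((x'^-1 * x)^-1) ^ x'^-1.
  by rewrite /conjg invgM !invgK !mulgA mulgK.
by apply: gpredJg; apply: gpredVr.
Qed.

Fact quotg_mulA : associative quotg_mul.
Proof.
move=> u v w; rewrite -[u]coset_repr -[v]coset_repr -[w]coset_repr.
by rewrite !quotg_mulE mulgA.
Qed.
Fact quotg_mul1 : left_id (coset 1) quotg_mul.
Proof. by move=> u; rewrite -[u]coset_repr quotg_mulE mul1g. Qed.
Fact quotg_mulr1 : right_id (coset 1) quotg_mul.
Proof. by move=> u; rewrite -[u]coset_repr quotg_mulE mulg1. Qed.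
Fact quotg_mulV : left_inverse (coset 1) quotg_inv quotg_mul.
Proof.
by move=> u; rewrite -[u]coset_repr quotg_invE quotg_mulE mulVg.
Qed.
Fact quotg_mulrV : right_inverse (coset 1) quotg_inv quotg_mul.
Proof.
by move=> u; rewrite -[u]coset_repr quotg_invE quotg_mulE mulgV.
Qed.

HB.instance Definition _ := isGroup.Build quotg
  quotg_mulA quotg_mul1 quotg_mulr1 quotg_mulV quotg_mulrV.

Fact coset_morph : {morph coset : x y / x * y}.
Proof. by move=> x y; rewrite -quotg_mulE. Qed.
HB.instance Definition _ := isMultiplicative.Build G quotg coset coset_morph.
End Quotient.

Section Induced.
Variables (G H : groupType) (f : {multiplicative G -> H}).

(* the map G/N -> H/M induced by f, when f maps N into M *)
Definition quot_map (N : normalClosed G) (M : normalClosed H)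
  (fNM : forall x, x \in N -> f x \in M) (u : quotg N) : quotg M :=
  coset M (f (repr u)).

Section QuotMap.
Variables (N : normalClosed G) (M : normalClosed H).
Hypothesis fNM : forall x, x \in N -> f x \in M.

Lemma quot_mapE x : quot_map fNM (coset N x) = coset M (f x).
Proof.
apply/eq_coset; rewrite -homV -gmulfM; apply: fNM.
by apply/eq_coset; rewrite coset_repr.
Qed.

Fact quot_map_morph : {morph quot_map fNM : u v / u * v}.
Proof.
move=> u v; rewrite -[u]coset_repr -[v]coset_repr -gmulfM !quot_mapE.
by rewrite !gmulfM.
Qed.
HB.instance Definition _ :=
  isMultiplicative.Build (quotg N) (quotg M) (quot_map fNM) quot_map_morph.
End QuotMap.

(* the restriction A -> B of f, when f maps A into B *)
Definition sub_map (A : groupClosed G) (B : groupClosed H)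
  (fAB : forall x, x \in A -> f x \in B) (u : subg A) : subg B :=
  exist _ (f (val u)) (fAB _ (valP u)).

Section SubMap.
Variables (A : groupClosed G) (B : groupClosed H).
Hypothesis fAB : forall x, x \in A -> f x \in B.
Fact sub_map_morph : {morph sub_map fAB : u v / u * v}.
Proof. by move=> u v; apply: val_inj; rewrite /= gmulfM. Qed.
HB.instance Definition _ :=
  isMultiplicative.Build (subg A) (subg B) (sub_map fAB) sub_map_morph.
End SubMap.
End Induced.

(* A/B; in all uses B is contained in A *)
Definition subquot (G : groupType) (A : groupClosed G) (B : normalClosed G) :
  groupType := quotg (preimg (@subg_val G A) B).

(* A law is a word in the variables x_0, ..., x_(r-1) and their inverses:
   the letter (i, false) stands for x_i, and (i, true) for its inverse. *)
Record law := Law { arity : nat; law_word : seq ('I_arity * bool) }.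

Section Verbal.
Variable V : set law.

Definition law_val (G : groupType) (v : law) (g : 'I_(arity v) -> G) : G :=
  \prod_(l <- law_word v) (if l.2 then (g l.1)^-1 else g l.1).

Lemma law_val_hom (G H : groupType) (f : {multiplicative G -> H}) v g :
  f (law_val g) = law_val (fun i : 'I_(arity v) => f (g i)).
Proof.
rewrite /law_val; elim: (law_word v) => [|[i b] w IHw].
  by rewrite !big_nil hom1.
by rewrite !big_cons gmulfM IHw /=; case: b => //=; rewrite homV.
Qed.

Definition verbal_gens (G : groupType) : set G :=
  [set x | exists2 v, V v & exists g : 'I_(arity v) -> G, x = law_val g].

Definition verbal (G : groupType) : {pred G} := generated (@verbal_gens G).
Arguments verbal : clear implicits.

Section VerbalNormal.
Variable G : groupType.
HB.instance Definition _ := GroupClosed.on (verbal G).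
Fact verbal_conj x g : x \in verbal G -> x ^ g \in verbal G.
Proof.
apply: generated_conj => {}x {}g [v Vv [h ->]]; exists v => //.
by exists (fun i => h i ^ g); rewrite -(law_val_hom (conjg_by g)).
Qed.
HB.instance Definition _ := isConjClosed.Build G (verbal G) verbal_conj.
End VerbalNormal.

Lemma verbal_hom (G H : groupType) (f : {multiplicative G -> H}) x :
  x \in verbal G -> f x \in verbal H.
Proof.
move=> /generatedP hx; apply: (hx (preimg f (verbal H))) => y [v Vv [g ->]].
apply: mem_generated; exists v => //; exists (fun i => f (g i)).
exact: law_val_hom.
Qed.

(* [vstar V N] is [NV*G]; its generators: *)
Definition vstar_gens (G : groupType) (N : {pred G}) : set G :=
  [set x | exists2 v, V v &
    exists (i : 'I_(arity v)) (g : 'I_(arity v) -> G) (n : G),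
      n \in N /\
      x = law_val (fun j => if j == i then g j * n else g j)
            * (law_val g)^-1].

Definition vstar (G : groupType) (N : {pred G}) : {pred G} :=
  generated (vstar_gens N).

Section VstarNormal.
Variables (G : groupType) (N : normalClosed G).
HB.instance Definition _ := GroupClosed.on (vstar N).
Fact vstar_conj x g : x \in vstar N -> x ^ g \in vstar N.
Proof.
apply: generated_conj => {}x {}g [v Vv [i [h [n [Nn ->]]]]]; exists v => //.
exists i, (fun j => h j ^ g), (n ^ g); split; first exact: gpredJg.
rewrite conjMg conjVg -!(law_val_hom (conjg_by g)).
congr (_ * _); rewrite -[LHS]/(conjg_by g _) law_val_hom.
by congr law_val; apply/funext => j; case: eqP => // _; exact: gmulfM.
Qed.
HB.instance Definition _ := isConjClosed.Build G (vstar N) vstar_conj.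

Lemma vstar_sub x : x \in vstar N -> x \in N.
Proof.
move=> /generatedP; apply=> _ [v Vv [i [g [n [Nn ->]]]]].
set a := law_val _; set b := law_val g.
suff /eq_coset/(gpredJg _ b^-1) : coset N b = coset N a.
  by rewrite /conjg invgK -mulgA mulVKg.
rewrite !law_val_hom; congr law_val; apply/funext => j.
case: eqP => // _; apply/eq_coset.
by rewrite mulKg.
Qed.
End VstarNormal.

Lemma vstar_mono (G : groupType) (M N : {pred G}) :
  (forall x, x \in M -> x \in N) ->
  forall x, x \in vstar M -> x \in vstar N.
Proof.
move=> MN x /generatedP; apply=> y [v Vv [i [g [n [Mn ->]]]]].
by apply: mem_generated; exists v => //; exists i, g, n; split; first exact: MN.
Qed.
End Verbal.
Arguments verbal : clear implicits.

Record simplicial_group := SimplicialGroup {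
  sg_ob :> nat -> groupType;
  face : forall n, 'I_n.+2 -> {multiplicative sg_ob n.+1 -> sg_ob n};
  degen : forall n, 'I_n.+1 -> {multiplicative sg_ob n -> sg_ob n.+1};
  face_face : forall n (x : sg_ob n.+2) i j, (i < j <= n.+2)%N ->
    face (inord i) (face (inord j) x) = face (inord j.-1) (face (inord i) x);
  degen_degen : forall n (x : sg_ob n) i j, (i <= j <= n)%N ->
    degen (inord i) (degen (inord j) x) = degen (inord j.+1) (degen (inord i) x);
  face_degen_lt : forall n (x : sg_ob n.+1) i j, (i < j <= n.+1)%N ->
    face (inord i) (degen (inord j) x) = degen (inord j.-1) (face (inord i) x);
  face_degen_eq : forall n (x : sg_ob n) j, (j <= n)%N ->
    face (inord j) (degen (inord j) x) = x;
  face_degen_succ : forall n (x : sg_ob n) j, (j <= n)%N ->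
    face (inord j.+1) (degen (inord j) x) = x;
  face_degen_gt : forall n (x : sg_ob n.+1) i j, (j.+1 < i <= n.+2)%N ->
    face (inord i) (degen (inord j) x) = degen (inord j) (face (inord i.-1) x)
}.
Arguments face {s n} i.
Arguments degen {s n} i.

Record simplicial_map (K L : simplicial_group) := SimplicialMap {
  sm_ob :> forall n, {multiplicative K n -> L n};
  sm_face : forall n (i : 'I_n.+2) x, sm_ob n (face i x) = face i (sm_ob n.+1 x);
  sm_degen : forall n (i : 'I_n.+1) x,
    sm_ob n.+1 (degen i x) = degen i (sm_ob n x)
}.

Section SimplicialVerbalQuotient.
Variable V : set law.

Definition vquot (G : groupType) : groupType := quotg (verbal V G).

Definition vquot_map (G H : groupType) (f : {multiplicative G -> H}) :
    {multiplicative vquot G -> vquot H} :=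
  quot_map (@verbal_hom V G H f).

Lemma vquot_mapE (G H : groupType) (f : {multiplicative G -> H}) x :
  vquot_map f (coset (verbal V G) x) = coset (verbal V H) (f x).
Proof. exact: quot_mapE. Qed.

Section Object.
Variable K : simplicial_group.
Let ob n := vquot (K n).
Let fc n (i : 'I_n.+2) := vquot_map (@face K n i).
Let dg n (i : 'I_n.+1) := vquot_map (@degen K n i).

Fact vquot_face_face n (x : ob n.+2) i j : (i < j <= n.+2)%N ->
  fc (inord i) (fc (inord j) x) = fc (inord j.-1) (fc (inord i) x).
Proof. by move=> ij; rewrite -[x]coset_repr /fc !vquot_mapE face_face. Qed.
Fact vquot_degen_degen n (x : ob n) i j : (i <= j <= n)%N ->
  dg (inord i) (dg (inord j) x) = dg (inord j.+1) (dg (inord i) x).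
Proof. by move=> ij; rewrite -[x]coset_repr /dg !vquot_mapE degen_degen. Qed.
Fact vquot_face_degen_lt n (x : ob n.+1) i j : (i < j <= n.+1)%N ->
  fc (inord i) (dg (inord j) x) = dg (inord j.-1) (fc (inord i) x).
Proof.
by move=> ij; rewrite -[x]coset_repr /fc /dg !vquot_mapE face_degen_lt.
Qed.
Fact vquot_face_degen_eq n (x : ob n) j : (j <= n)%N ->
  fc (inord j) (dg (inord j) x) = x.
Proof.
by move=> ij; rewrite -[x]coset_repr /fc /dg !vquot_mapE face_degen_eq.
Qed.
Fact vquot_face_degen_succ n (x : ob n) j : (j <= n)%N ->
  fc (inord j.+1) (dg (inord j) x) = x.
Proof.
by move=> ij; rewrite -[x]coset_repr /fc /dg !vquot_mapE face_degen_succ.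
Qed.
Fact vquot_face_degen_gt n (x : ob n.+1) i j : (j.+1 < i <= n.+2)%N ->
  fc (inord i) (dg (inord j) x) = dg (inord j) (fc (inord i.-1) x).
Proof.
by move=> ij; rewrite -[x]coset_repr /fc /dg !vquot_mapE face_degen_gt.
Qed.

(* the simplicial group K/V(K) *)
Definition simplicial_vquot : simplicial_group :=
  SimplicialGroup vquot_face_face vquot_degen_degen vquot_face_degen_lt
    vquot_face_degen_eq vquot_face_degen_succ vquot_face_degen_gt.
End Object.

Section Map.
Variables (K L : simplicial_group) (a : simplicial_map K L).
Let am n := vquot_map (a n).
Fact vquot_sm_face n (i : 'I_n.+2) (x : simplicial_vquot K n.+1) :
  am n (face i x) = @face (simplicial_vquot L) n i (am n.+1 x).
Proof.
by rewrite -[x]coset_repr /am /= !vquot_mapE sm_face.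
Qed.
Fact vquot_sm_degen n (i : 'I_n.+1) (x : simplicial_vquot K n) :
  am n.+1 (degen i x) = @degen (simplicial_vquot L) n i (am n x).
Proof.
by rewrite -[x]coset_repr /am /= !vquot_mapE sm_degen.
Qed.

(* the map a/V(a) : K/V(K) -> L/V(L) *)
Definition simplicial_vquot_map :
    simplicial_map (simplicial_vquot K) (simplicial_vquot L) :=
  @SimplicialMap (simplicial_vquot K) (simplicial_vquot L) am
    vquot_sm_face vquot_sm_degen.
End Map.
End SimplicialVerbalQuotient.

Section SimplicialKernel.
Variables (K L : simplicial_group) (a : simplicial_map K L).

Fact simplicial_ker_face n (i : 'I_n.+2) x :
  x \in kerg (a n.+1) -> face i x \in kerg (a n).
Proof. by move=> /eqP ax; apply/eqP; rewrite sm_face ax hom1. Qed.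
Fact simplicial_ker_degen n (i : 'I_n.+1) x :
  x \in kerg (a n) -> degen i x \in kerg (a n.+1).
Proof. by move=> /eqP ax; apply/eqP; rewrite sm_degen ax hom1. Qed.

Let ob n : groupType := subg (kerg (a n)).
Let fc n (i : 'I_n.+2) : {multiplicative ob n.+1 -> ob n} :=
  sub_map (@simplicial_ker_face n i).
Let dg n (i : 'I_n.+1) : {multiplicative ob n -> ob n.+1} :=
  sub_map (@simplicial_ker_degen n i).

Fact simplicial_ker_face_face n (x : ob n.+2) i j : (i < j <= n.+2)%N ->
  fc (inord i) (fc (inord j) x) = fc (inord j.-1) (fc (inord i) x).
Proof. by move=> ij; apply/val_inj/face_face. Qed.
Fact simplicial_ker_degen_degen n (x : ob n) i j : (i <= j <= n)%N ->
  dg (inord i) (dg (inord j) x) = dg (inord j.+1) (dg (inord i) x).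
Proof. by move=> ij; apply/val_inj/degen_degen. Qed.
Fact simplicial_ker_face_degen_lt n (x : ob n.+1) i j : (i < j <= n.+1)%N ->
  fc (inord i) (dg (inord j) x) = dg (inord j.-1) (fc (inord i) x).
Proof. by move=> ij; apply/val_inj/face_degen_lt. Qed.
Fact simplicial_ker_face_degen_eq n (x : ob n) j : (j <= n)%N ->
  fc (inord j) (dg (inord j) x) = x.
Proof. by move=> ij; apply/val_inj/face_degen_eq. Qed.
Fact simplicial_ker_face_degen_succ n (x : ob n) j : (j <= n)%N ->
  fc (inord j.+1) (dg (inord j) x) = x.
Proof. by move=> ij; apply/val_inj/face_degen_succ. Qed.
Fact simplicial_ker_face_degen_gt n (x : ob n.+1) i j : (j.+1 < i <= n.+2)%N ->
  fc (inord i) (dg (inord j) x) = dg (inord j) (fc (inord i.-1) x).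
Proof. by move=> ij; apply/val_inj/face_degen_gt. Qed.

Definition simplicial_ker : simplicial_group :=
  SimplicialGroup simplicial_ker_face_face simplicial_ker_degen_degen
    simplicial_ker_face_degen_lt simplicial_ker_face_degen_eq
    simplicial_ker_face_degen_succ simplicial_ker_face_degen_gt.
End SimplicialKernel.

(* Homotopy groups, as the homology groups of the Moore complex, normalized by
   N_n = the intersection of ker d_i over 0 < i <= n, with differential d_0.
   So pi_n = cycles / boundaries, with cycles = N_n /\ ker d_0 (= K_0 if n = 0)
   and boundaries = d_0 (N_(n+1)). *)
Section Homotopy.
Variable K : simplicial_group.

Definition moore (n : nat) : {pred K n} :=
  match n with
  | 0 => predT
  | m.+1 => [pred x : K m.+1 | [forall i : 'I_m.+2, (i != ord0) ==> (face i x == 1)]]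
  end.
Arguments moore : clear implicits.

Definition cycles (n : nat) : {pred K n} :=
  match n with
  | 0 => predT
  | m.+1 => [pred x : K m.+1 | (x \in moore m.+1) && (face ord0 x == 1)]
  end.
Arguments cycles : clear implicits.

Definition boundaries (n : nat) : {pred K n} :=
  [pred x | `[< exists2 y, y \in moore n.+1 & face ord0 y = x >]].
Arguments boundaries : clear implicits.

Lemma mooreP n (x : K n.+1) :
  reflect (forall i : 'I_n.+2, i != ord0 -> face i x = 1) (x \in moore n.+1).
Proof.
apply: (iffP forallP) => [h i i0 | h i]; first by apply/eqP/(implyP (h i)).
by apply/implyP => i0; apply/eqP/h.
Qed.

Lemma cyclesP n (x : K n.+1) :
  reflect (forall i : 'I_n.+2, face i x = 1) (x \in cycles n.+1).
Proof.
apply: (iffP andP) => [[/mooreP h /eqP h0] i | h].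
  by have [-> | /h] := eqVneq i ord0.
by split; [apply/mooreP => i _; apply: h | apply/eqP/h].
Qed.

Lemma boundariesP n (x : K n) :
  reflect (exists2 y, y \in moore n.+1 & face ord0 y = x) (x \in boundaries n).
Proof. exact: asboolP. Qed.

Fact cycles_mul_closed n : mulg_closed (cycles n).
Proof.
case: n => // n x y /cyclesP hx /cyclesP hy.
by apply/cyclesP => i; rewrite gmulfM hx hy mulg1.
Qed.
Fact cycles_one_closed n : 1 \in cycles n.
Proof. by case: n => // n; apply/cyclesP => i; rewrite hom1. Qed.
Fact cycles_inv_closed n : invg_closed (cycles n).
Proof.
by case: n => // n x /cyclesP hx; apply/cyclesP => i; rewrite homV hx invg1.
Qed.
HB.instance Definition _ n := isMulClosed.Build (K n) (cycles n) (@cycles_mul_closed n).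
HB.instance Definition _ n := isMul1Closed.Build (K n) (cycles n) (@cycles_one_closed n).
HB.instance Definition _ n := isInvClosed.Build (K n) (cycles n) (@cycles_inv_closed n).

Fact boundaries_mul_closed n : mulg_closed (boundaries n).
Proof.
move=> _ _ /boundariesP[x /mooreP hx <-] /boundariesP[y /mooreP hy <-].
apply/boundariesP; exists (x * y); last exact: gmulfM.
by apply/mooreP => i i0; rewrite gmulfM hx ?hy ?mulg1.
Qed.
Fact boundaries_one_closed n : 1 \in boundaries n.
Proof.
apply/boundariesP; exists 1; last exact: hom1.
by apply/mooreP => i _; rewrite hom1.
Qed.
Fact boundaries_inv_closed n : invg_closed (boundaries n).
Proof.
move=> _ /boundariesP[x /mooreP hx <-].
apply/boundariesP; exists x^-1; last exact: homV.
by apply/mooreP => i i0; rewrite homV hx ?invg1.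
Qed.
Fact boundaries_conj_closed n x g : x \in boundaries n -> x ^ g \in boundaries n.
Proof.
move=> /boundariesP[y /mooreP hy <-].
have i0 : inord 0 = ord0 :> 'I_n.+2 by apply: val_inj; rewrite /= inordK.
apply/boundariesP; exists (y ^ degen (inord 0) g).
  by apply/mooreP => i i_neq0; rewrite homJ hy ?conj1g.
by rewrite homJ -i0 face_degen_eq.
Qed.
HB.instance Definition _ n :=
  isMulClosed.Build (K n) (boundaries n) (@boundaries_mul_closed n).
HB.instance Definition _ n :=
  isMul1Closed.Build (K n) (boundaries n) (@boundaries_one_closed n).
HB.instance Definition _ n :=
  isInvClosed.Build (K n) (boundaries n) (@boundaries_inv_closed n).
HB.instance Definition _ n :=
  isConjClosed.Build (K n) (boundaries n) (@boundaries_conj_closed n).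

Lemma boundaries_sub n x : x \in boundaries n -> x \in cycles n.
Proof.
case: n x => // n _ /boundariesP[x /mooreP hx <-]; apply/cyclesP => i.
have in0 : inord 0 = ord0 :> 'I_n.+2 by apply: val_inj; rewrite /= inordK.
have in0' : inord 0 = ord0 :> 'I_n.+3 by apply: val_inj; rewrite /= inordK.
have ltin : (i.+1 < n.+3)%N by rewrite ltnS.
rewrite -[i]inord_val -in0' -[i : nat]/(i.+1.-1) -face_face ?hx ?hom1 //.
by apply/eqP => /(congr1 val); rewrite /= inordK.
Qed.

Definition homotopy_group (n : nat) : groupType :=
  subquot (cycles n) (boundaries n).

Definition pi0_class (x : K 0) : homotopy_group 0 :=
  coset _ (exist _ x (erefl true) : subg (cycles 0)).
End Homotopy.

Arguments moore : clear implicits.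
Arguments cycles : clear implicits.
Arguments boundaries : clear implicits.

(* X freely generates F *)
Definition free_basis (F : groupType) (X : set F) : Prop :=
  forall (H : groupType) (f : F -> H),
    exists2 phi : {multiplicative F -> H}, (forall x, X x -> phi x = f x) &
      forall psi : {multiplicative F -> H},
        (forall x, X x -> psi x = f x) -> psi =1 phi.

Definition is_free (F : groupType) : Prop := exists X : set F, free_basis X.

Definition free_simplicial (K : simplicial_group) : Prop :=
  exists X : forall n, set (K n),
    (forall n, free_basis (X n)) /\
    (forall n (i : 'I_n.+1) x, X n x -> X n.+1 (degen i x)).

(* A functorial choice of a free simplicial resolution of every group; the
   isomorphism pi_0 (res G) = G is natural in G. *)
Record free_resolution := FreeResolution {
  res :> groupType -> simplicial_group;
  res_map : forall G H : groupType, {multiplicative G -> H} ->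
    simplicial_map (res G) (res H);
  res_id : forall (G : groupType) n (x : res G n),
    res_map [the {multiplicative G -> G} of idfun] n x = x;
  res_comp : forall (G H J : groupType) (g : {multiplicative H -> J})
      (f : {multiplicative G -> H}) n (x : res G n),
    res_map [the {multiplicative G -> J} of g \o f] n x
      = res_map g n (res_map f n x);
  res_free : forall G, free_simplicial (res G);
  res_aug : forall G, {multiplicative homotopy_group (res G) 0 -> G};
  res_aug_bij : forall G, bijective (res_aug G);
  res_aug_nat : forall (G H : groupType) (f : {multiplicative G -> H})
      (x : res G 0),
    res_aug H (pi0_class (res_map f 0 x)) = f (res_aug G (pi0_class x));
  res_acyclic : forall G m, (0 < m)%N ->
    forall u : homotopy_group (res G) m, u = 1
}.

(* The Baer invariant VM(G,N) = pi_1 (ker (a/V(a))), where a : K -> L is induced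
   by the projection G -> G/N. *)
Definition baer_invariant (V : set law) (K : free_resolution)
    (G : groupType) (N : normalClosed G) : groupType :=
  homotopy_group
    (simplicial_ker (simplicial_vquot_map V
       (res_map K [the {multiplicative G -> quotg N} of coset N]))) 1.

Definition has_complement (G : groupType) (N : {pred G}) : Prop :=
  exists H : groupClosed G,
    (forall x, x \in H -> x \in N -> x = 1) /\
    (forall g, exists h n, [/\ h \in H, n \in N & g = h * n]).

(* Main.v *)
(* By functoriality a complement of N splits the map alpha : A -> B of
   resolutions of G and G/N.  Write d_0, d_1 for the faces, R_0 for the kernel
   of A_0 -> G, which is d_0 (ker d_1), and S_0 for the kernel of A_0 -> G/N.
   Every class in pi_1 of ker (alpha / V(alpha)) is represented by an x in A_1
   with d_1 x = 1 and alpha x in V(B_1), and x |-> d_0 x identifies this pi_1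
   with (R_0 /\ [S_0 V* A_0]) / [R_0 V* A_0]: the faces agree modulo
   [R_0 V* A_0] on V(A_1), every element of [R_0 V* A_0] is d_0 z for some
   z in V(A_1) with d_1 z = 1, and A, B have trivial pi_1.  Since A_0 and F are
   free, there are maps A_0 -> F -> A_0 over G; their composites are the
   identity modulo R_0 and R, hence the identity modulo [R_0 V* A_0] and
   [R V* F] on the verbal subgroups, so the quotient can be computed in F. *)
Require Import Defs.
From HB Require Import structures.
From mathcomp Require Import all_boot boolp classical_sets.
Set Implicit Arguments.
Unset Strict Implicit.
Unset Printing Implicit Defensive.
Local Open Scope group_scope.

(** * Morphisms, words and verbal subgroups modulo a normal subgroup *)

Lemma multiplicative_eq (G H : groupType) (f g : {multiplicative G -> H}) :
  f =1 g -> f = g.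
Proof.
case: f g => [f [[pf]]] [g [[pg]]] /= /funext fg; case: _ / fg in pg *.
by rewrite (Prop_irrelevance pf pg).
Qed.

Lemma mem_preimg (G H : groupType) (f : {multiplicative G -> H})
  (M : {pred H}) x : (x \in preimg f M) = (f x \in M).
Proof. by []. Qed.

Definition mk_subg (G : groupType) (S : groupClosed G) x (xS : x \in S) :
    subg S :=
  exist (fun y => y \in S) x xS.

Lemma coset_eq1 (G : groupType) (N : normalClosed G) x :
  coset N x = 1 <-> x \in N.
Proof. by rewrite -(hom1 (coset N)) eq_coset mulg1 gpredV. Qed.

Lemma coset1 (G : groupType) (N : normalClosed G) : coset N 1 = 1.
Proof. exact: hom1. Qed.

Lemma cosetM (G : groupType) (N : normalClosed G) x y :
  coset N (x * y) = coset N x * coset N y.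
Proof. exact: coset_morph. Qed.

Lemma cosetV (G : groupType) (N : normalClosed G) x :
  coset N x^-1 = (coset N x)^-1.
Proof. exact: homV. Qed.

Lemma generated_ind (G : groupType) (A : set G) (P : G -> Prop) :
  P 1 -> (forall x y, P x -> P y -> P (x * y)) -> (forall x, P x -> P x^-1) ->
  (forall x, A x -> P x) -> forall x, x \in generated A -> P x.
Proof.
move=> P1 PM PV AP x /generatedP gx.
(* Membership in [generated A] tests every bundled subgroup, so [P] is packed into one. *)
pose S : {pred G} := [pred x | `[<P x>]].
have SM : mulg_closed S by move=> y z /asboolP Py /asboolP Pz; apply/asboolP/PM.
have S1 : 1 \in S by apply/asboolP.
have SV : invg_closed S by move=> y /asboolP Py; apply/asboolP/PV.
pose m1 := isMulClosed.Build G S SM.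
pose m2 := isMul1Closed.Build G S S1.
pose m3 := isInvClosed.Build G S SV.
pose S' : groupClosed G := HB.pack S m1 m2 m3.
by apply/asboolP; apply: (gx S') => y /AP Py; apply/asboolP.
Qed.

(* [g] is changed into [h] one variable at a time. *)
Lemma law_val_mod (V : set law) (G : groupType) (N : normalClosed G) v
    (g h : 'I_(arity v) -> G) :
  V v -> (forall i, coset N (g i) = coset N (h i)) ->
  coset (vstar V N) (law_val g) = coset (vstar V N) (law_val h).
Proof.
move=> Vv gh; pose mix k (i : 'I_(arity v)) := if (i < k)%N then h i else g i.
suff mixP k : (k <= arity v)%N ->
    coset (vstar V N) (law_val (mix k)) = coset (vstar V N) (law_val g).
  rewrite -(mixP _ (leqnn _)); congr (coset _ (law_val _)); apply/funext => i.
  by rewrite /mix ltn_ord.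
elim: k => [_|k IHk ltk].
  by congr (coset _ (law_val _)); apply/funext => i; rewrite /mix ltn0.
rewrite -IHk 1?ltnW //; set i := Ordinal ltk.
suff: coset (vstar V N) (law_val (mix k.+1) * (law_val (mix k))^-1) = 1.
  by rewrite cosetM cosetV => /eqP; rewrite divg_eq1 => /eqP.
apply/coset_eq1/mem_generated; exists v => //.
exists i, (mix k), ((g i)^-1 * h i); split; first exact/eq_coset.
congr (law_val _ * _); apply/funext => j; rewrite /mix ltnS leq_eqVlt.
have [->|ji] := eqVneq j i; first by rewrite /= eqxx ltnn mulVKg.
suff -> : (j == k :> nat) = false by [].
by apply/negP => /eqP jk; case/eqP: ji; apply: val_inj.
Qed.

(** On values of laws this is [law_val_mod]; products and inverses follow. It serves to compare d_0
    with d_1, [s \o a] with the identity, and the round trips between A_0 and [F] with the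
    identity. *)
Lemma verbal_mod (V : set law) (G H : groupType) (N : normalClosed H)
    (f g : {multiplicative G -> H}) :
  (forall x, coset N (f x) = coset N (g x)) ->
  forall x, x \in verbal V G ->
    coset (vstar V N) (f x) = coset (vstar V N) (g x).
Proof.
move=> fg; apply: generated_ind => [|x y|x|x].
- by rewrite !hom1.
- by rewrite 2!gmulfM 2!cosetM => -> ->.
- by rewrite 2!homV 2!cosetV => ->.
by move=> [v Vv [k ->]]; rewrite (law_val_hom f) (law_val_hom g);
  apply: law_val_mod.
Qed.

Lemma vstar_hom (V : set law) (G H : groupType) (N : {pred G}) (M : {pred H})
    (f : {multiplicative G -> H}) :
  (forall x, x \in N -> f x \in M) ->
  forall x, x \in vstar V N -> f x \in vstar V M.
Proof.
move=> NM; apply: generated_ind => [|x y|x|x].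
- by rewrite hom1 gpred1.
- by rewrite gmulfM; apply: gpredM.
- by rewrite homV; apply: gpredVr.
move=> [v Vv [i [g [n [Nn ->]]]]]; apply: mem_generated; exists v => //.
exists i, (fun j => f (g j)), (f n); split; first exact: NM.
rewrite gmulfM homV !law_val_hom; congr (law_val _ * _).
by apply/funext => j; case: ifP => // _; rewrite gmulfM.
Qed.

Lemma vstar_verbal (V : set law) (G : groupType) (N : {pred G}) x :
  x \in vstar V N -> x \in verbal V G.
Proof.
move: x; apply: generated_ind => [|x y|x|x].
- exact: gpred1.
- exact: gpredM.
- exact: gpredVr.
move=> [v Vv [i [g [n [_ ->]]]]].
by apply: gpredM; last apply: gpredVr; apply: mem_generated; exists v => //;
  eexists.
Qed.

(* A subgroup of [G * H] that is total on both sides and relates [M] only to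
   [N] is the graph of an isomorphism [G/M = H/N]. *)
Lemma quotg_isomorphic (G H : groupType) (M : normalClosed G)
    (N : normalClosed H) (T : G -> H -> Prop) :
  (forall x y x' y', T x y -> T x' y' -> T (x * x') (y * y')) ->
  (forall x y, T x y -> T x^-1 y^-1) ->
  (forall x, exists y, T x y) -> (forall y, exists x, T x y) ->
  (forall x y, T x y -> (x \in M) = (y \in N)) ->
  isomorphic (quotg M) (quotg N).
Proof.
move=> TM TV totl totr TMN.
have Tcoset x y x' y' : T x y -> T x' y' ->
    coset M x = coset M x' <-> coset N y = coset N y'.
  move=> xy xy'; rewrite !eq_coset (TMN _ (y^-1 * y')) //.
  by apply: TM => //; apply: TV.
have [t Tt] := choice totl.
pose f (u : quotg M) : quotg N := coset N (t (repr u)).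
have fE x y : T x y -> f (coset M x) = coset N y.
  by move=> xy; apply/(Tcoset _ _ _ _ (Tt _) xy); rewrite coset_repr.
have fM : {morph f : u v / u * v}.
  move=> u v; rewrite -[u]coset_repr -[v]coset_repr -gmulfM.
  by rewrite (fE _ _ (TM _ _ _ _ (Tt _) (Tt _))) !(fE _ _ (Tt _)) gmulfM.
have [q Tq] := choice totr.
pose mf := isMultiplicative.Build _ _ f fM.
pose f' : {multiplicative quotg M -> quotg N} := HB.pack f mf.
exists f' => /=.
exists (fun v => coset M (q (repr v))) => [u|v].
  rewrite -[RHS]coset_repr; apply/(Tcoset _ _ _ _ (Tq _) (Tt _)).
  by rewrite coset_repr.
by rewrite (fE _ _ (Tq _)) coset_repr.
Qed.

(** * Simplicial groups in degrees 0, 1 and 2 *)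

Section LowDegrees.
Variable A : simplicial_group.

Lemma moore1P (x : A 1%N) : x \in moore A 1%N <-> face (inord 1) x = 1.
Proof.
split=> [/mooreP -> //|x1].
  by apply/eqP => /(congr1 val); rewrite /= inordK.
apply/mooreP => i i0; rewrite -x1; congr (face _ x); apply: val_inj.
by rewrite /= inordK //; case: i i0 => [[|[|i]]].
Qed.

Lemma moore2P (x : A 2%N) :
  x \in moore A 2%N <-> face (inord 1) x = 1 /\ face (inord 2) x = 1.
Proof.
split=> [/mooreP h|[x1 x2]].
  by split; apply: h; apply/eqP => /(congr1 val); rewrite /= inordK.
apply/mooreP => i i0; have [i1|i2] : i = inord 1 \/ i = inord 2.
- by case: i i0 => [[|[|[|i]]]] // lti _; [left|right]; apply: val_inj;
    rewrite /= inordK.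
- by rewrite i1.
by rewrite i2.
Qed.

Lemma cycles1P (x : A 1%N) :
  x \in cycles A 1%N <-> face (inord 0) x = 1 /\ face (inord 1) x = 1.
Proof.
split=> [/cyclesP h //|[x0 x1]]; apply/cyclesP => i.
have [->|->] // : i = inord 0 \/ i = inord 1.
by case: i => [[|[|i]]] // lti; [left|right]; apply: val_inj; rewrite /= inordK.
Qed.

Lemma inord0 n : inord 0 = ord0 :> 'I_n.+1.
Proof. by apply: val_inj; rewrite /= inordK. Qed.

Lemma boundaries0P (x : A 0%N) : x \in boundaries A 0%N <->
  exists y : A 1%N, face (inord 1) y = 1 /\ face (inord 0) y = x.
Proof.
rewrite inord0; split=> [/boundariesP[y /moore1P]|[y [/moore1P]]].
  by exists y.
by move=> y1 yx; apply/boundariesP; exists y.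
Qed.

Lemma boundaries1P (x : A 1%N) : x \in boundaries A 1%N <->
  exists y : A 2%N,
    [/\ face (inord 1) y = 1, face (inord 2) y = 1 & face (inord 0) y = x].
Proof.
rewrite inord0; split=> [/boundariesP[y /moore2P[]]|[y []]]; first by exists y.
by move=> y1 y2 yx; apply/boundariesP; exists y => //; apply/moore2P.
Qed.

Lemma coset_faces (x : A 1%N) :
  coset (boundaries A 0%N) (face (inord 0) x)
    = coset (boundaries A 0%N) (face (inord 1) x).
Proof.
(* This element is killed by d_1, and d_0 sends it to (d_0 x)^-1 d_1 x. *)
apply/eq_coset/boundaries0P; exists (x^-1 * degen (inord 0) (face (inord 1) x)).
rewrite !gmulfM !homV (@face_degen_succ A 0%N _ 0) //.
by rewrite (@face_degen_eq A 0%N _ 0) // mulVg.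
Qed.

Variable V : set law.

Lemma verbal_faces x : x \in verbal V (A 1%N) ->
  coset (vstar V (boundaries A 0%N)) (face (inord 0) x)
    = coset (vstar V (boundaries A 0%N)) (face (inord 1) x).
Proof. exact/verbal_mod/coset_faces. Qed.

Lemma verbal_face0_vstar x : x \in verbal V (A 1%N) -> face (inord 1) x = 1 ->
  face (inord 0) x \in vstar V (boundaries A 0%N).
Proof.
by move=> /verbal_faces x01 x1; apply/coset_eq1; rewrite x01 x1 hom1.
Qed.

Lemma vstar_face0 w : w \in vstar V (boundaries A 0%N) ->
  exists2 z, z \in verbal V (A 1%N)
    & face (inord 1) z = 1 /\ face (inord 0) z = w.
Proof.
move: w; apply: generated_ind => [|x y|x|x].
- by exists 1; rewrite ?gpred1 // !hom1.
- move=> [z Vz [z1 <-]] [t Vt [t1 <-]]; exists (z * t); first exact: gpredM.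
  by rewrite !gmulfM z1 t1 mulg1.
- by move=> [z Vz [z1 <-]]; exists z^-1; rewrite ?gpredV // !homV z1 invg1.
move=> [v Vv [i [g [_ [/boundaries0P[m [m1 <-]] ->]]]]].
(* Both faces of the degenerate [s j] are [g j]. Hence d_0 sends [z] to the given generator, while
   d_1 [z] is trivial because d_1 kills [m]. *)
pose s j := @degen A 0 (inord 0) (g j).
pose z := law_val (fun j => if j == i then s j * m else s j) * (law_val s)^-1.
have faceE k : (forall j, face k (s j) = g j) -> face k z =
    law_val (fun j => if j == i then g j * face k m else g j) * (law_val g)^-1.
  move=> sk; rewrite gmulfM homV !(law_val_hom (face k)).
  have -> : (fun j => face k (s j)) = g by apply/funext.
  congr (law_val _ * _); apply/funext => j.
  by case: ifP; rewrite ?gmulfM sk.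
exists z; first by apply: gpredM; last apply: gpredVr; apply: mem_generated;
  exists v => //; eexists.
split; last by apply: faceE => j; rewrite (@face_degen_eq A 0 _ 0).
rewrite faceE => [|j]; last by rewrite (@face_degen_succ A 0 _ 0).
suff -> : (fun j => if j == i then g j * face (inord 1) m else g j) = g.
  by rewrite mulgV.
by apply/funext => j; rewrite m1 mulg1 if_same.
Qed.

Lemma face0_moore2 (y : A 2%N) : face (inord 1) y = 1 -> face (inord 2) y = 1 ->
  face (inord 0) y \in cycles A 1%N.
Proof.
move=> y1 y2; apply/cycles1P.
rewrite -(@face_face A 0%N _ 0 1) // -(@face_face A 0%N _ 0 2) //.
by rewrite y1 y2 !hom1.
Qed.

End LowDegrees.

(** * Split maps of aspherical simplicial groups *)

Section SplitMap.
Variables (V : set law) (A B : simplicial_group).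
Variables (a : simplicial_map A B) (s : simplicial_map B A).
Hypothesis sK : forall n, cancel (s n) (a n).
Hypothesis aspherical : forall x, x \in cycles A 1 -> x \in boundaries A 1.
Hypothesis asphericalB : forall x, x \in cycles B 1 -> x \in boundaries B 1.

Local Notation R0 := (boundaries A 0).
Local Notation S0 := (preimg (a 0%N) (boundaries B 0)).

(** The endomorphism [s \o a] is the identity modulo S_0, hence modulo [S_0 V* A_0] on V(A_0), and
    it sends [y] into [S_0 V* A_0]. *)
Lemma split_vstar y : y \in verbal V (A 0%N) ->
  a 0%N y \in vstar V (boundaries B 0) -> y \in vstar V S0.
Proof.
move=> Vy ay; pose e : {multiplicative A 0%N -> A 0%N} := s 0%N \o a 0%N.
have eS x : coset S0 (idfun x) = coset S0 (e x).
  by apply/eq_coset; rewrite mem_preimg gmulfM homV /= sK mulVg gpred1.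
apply/coset_eq1; rewrite (verbal_mod eS Vy); apply/coset_eq1.
by apply: vstar_hom ay => x xB; rewrite mem_preimg sK.
Qed.

Lemma face0_vstar (x : A 1%N) : face (inord 1) x = 1 ->
  face (inord 0) x \in verbal V (A 0%N) -> a 1%N x \in verbal V (B 1%N) ->
  face (inord 0) x \in vstar V S0.
Proof.
move=> x1 Vx0 Vax; apply: split_vstar => //; rewrite sm_face.
by apply: verbal_face0_vstar => //; rewrite -sm_face x1 hom1.
Qed.

(** This gives surjectivity: any d_0-preimage of [w] in the kernel of d_1 is corrected by a cycle of
    A_1 until its image in B_1 is verbal. *)
Lemma vstar_lift_face0 w : w \in R0 -> w \in vstar V S0 -> exists x : A 1%N,
  [/\ face (inord 1) x = 1, face (inord 0) x = w
    & a 1%N x \in verbal V (B 1%N)].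
Proof.
move=> /boundaries0P[x [x1 x0]] wS.
have /vstar_face0[z Vz [z1 z0]] : a 0%N w \in vstar V (boundaries B 0).
  by apply: vstar_hom wS.
(* The verbal element [z] has the same faces as [a x], so the quotient of the two is a cycle and
   bounds in B. *)
have /asphericalB/boundaries1P[y [y1 y2 y0]] : a 1%N x * z^-1 \in cycles B 1.
  by apply/cycles1P; rewrite !gmulfM !homV -!sm_face x1 x0 z1 z0 hom1 !mulgV.
(* The cycle [t] lies over that quotient: dividing [x] by it keeps both faces and moves the image in
   B_1 to [z]. *)
pose t := face (inord 0) (s 2%N y).
have /cycles1P[t0 t1] : t \in cycles A 1.
  by apply: face0_moore2; rewrite -sm_face ?y1 ?y2 hom1.
exists (t^-1 * x); rewrite !gmulfM !homV t0 t1 x1 x0 invg1 !mul1g; split=> //.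
by rewrite sm_face sK y0 invgM invgK mulgVK.
Qed.

(** Since d_0 d_0 y = d_0 d_1 y and d_1 d_0 y = d_0 d_2 y, and d_0 agrees with d_1 on V(A_1) modulo
    [R_0 V* A_0], both are congruent to d_1 d_1 y = d_1 d_2 y. So x |-> d_0 x kills boundaries. *)
Lemma boundary_face0 (x : A 1%N) (y : A 2%N) : face (inord 1) x = 1 ->
  face (inord 1) y \in verbal V (A 1%N) ->
  face (inord 2) y \in verbal V (A 1%N) ->
  x^-1 * face (inord 0) y \in verbal V (A 1%N) ->
  face (inord 0) x \in vstar V R0.
Proof.
move=> x1 Vy1 Vy2 /verbal_faces.
rewrite !(@gmulfM _ _ (face _)) !(homV (face _)) x1 invg1 mul1g.
rewrite !cosetM cosetV.
rewrite -(@face_face A 0 _ 0 1) // -(@face_face A 0 _ 0 2) //.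
rewrite (verbal_faces Vy1) (verbal_faces Vy2) (@face_face A 0 _ 1 2) //=.
move=> /(canRL (mulgK _)); rewrite mulgV => /eqP.
by rewrite invg_eq1 => /eqP/coset_eq1.
Qed.

(** This gives injectivity: dividing [x] by a verbal [z] with the same faces leaves a cycle, which
    bounds in A. *)
Lemma face0_boundary (x : A 1%N) : face (inord 1) x = 1 ->
  a 1%N x \in verbal V (B 1%N) -> face (inord 0) x \in vstar V R0 ->
  exists y : A 2%N, [/\ face (inord 1) y = 1, face (inord 2) y = 1,
    a 2%N y = 1 & coset (verbal V _) (face (inord 0) y) = coset (verbal V _) x].
Proof.
move=> x1 Vax /vstar_face0[z Vz [z1 z0]].
have /aspherical/boundaries1P[y [y1 y2 y0]] : x * z^-1 \in cycles A 1.
  by apply/cycles1P; rewrite !gmulfM !homV x1 z1 z0 !mulgV.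
(* the splitting corrects [y] into the kernel of [a] *)
exists (y * (s 2%N (a 2%N y))^-1).
rewrite !(@gmulfM _ _ (face _)) !(homV (face _)) (@gmulfM _ _ (a _)) homV sK.
rewrite mulgV -!sm_face y0 y1 y2 !hom1 mulgV; split=> //.
(* The correcting factor has verbal d_0, so it does not change the class of d_0 [y]. *)
have /coset_eq1 Vsax : s 1%N (a 1%N (x * z^-1)) \in verbal V (A 1%N).
  apply: verbal_hom; rewrite gmulfM homV gpredM // gpredVr //.
  exact: verbal_hom.
move: Vz => /coset_eq1 Vz.
by rewrite !cosetM !cosetV Vsax Vz invg1 !mulg1.
Qed.

(** * Passage from A_0 to a presentation F/R *)

Section Presentation.
Variables (F : groupType) (R S : normalClosed F).
Variables (f : {multiplicative A 0%N -> F}) (h : {multiplicative F -> A 0%N}).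
Hypothesis fR : forall x, x \in R0 -> f x \in R.
Hypothesis fS : forall x, x \in S0 -> f x \in S.
Hypothesis hR : forall x, x \in R -> h x \in R0.
Hypothesis hS : forall x, x \in S -> h x \in S0.
Hypothesis fK : forall x, coset R0 (h (f x)) = coset R0 x.
Hypothesis hK : forall x, coset R (f (h x)) = coset R x.

Local Notation C := (simplicial_ker (simplicial_vquot_map V a)).

Lemma mem_kerC n (x : A n) :
  (coset (verbal V (A n)) x \in kerg (simplicial_vquot_map V a n))
    = (a n x \in verbal V (B n)).
Proof. by rewrite inE /= vquot_mapE; apply/eqP/idP => /coset_eq1. Qed.

Lemma baer_presentation :
  isomorphic (homotopy_group C 1) (subquot (capg R (vstar V S)) (vstar V R)).
Proof.
have [v vE] : exists v : {multiplicative subg (cycles C 1) -> vquot V (A 1%N)},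
    forall u, v u = val (val u).
  pose v0 : {multiplicative subg (kerg (simplicial_vquot_map V a 1%N)) -> _} :=
    @subg_val _ _.
  by exists (v0 \o @subg_val _ (cycles C 1)).
(* A relation, since the representative [x] of [u] with d_1 x = 1 is not unique. *)
pose T (u : subg (cycles C 1)) (w : subg (capg R (vstar V S))) :=
  exists x : A 1%N, [/\ coset (verbal V _) x = v u, face (inord 1) x = 1
    & coset (vstar V R) (f (face (inord 0) x)) = coset (vstar V R) (val w)].
have uP (u : subg (cycles C 1)) x : coset (verbal V _) x = v u ->
    [/\ face (inord 0) x \in verbal V (A 0%N),
        face (inord 1) x \in verbal V (A 0%N)
      & a 1%N x \in verbal V (B 1%N)].
  rewrite vE => xu.
  have /cycles1P[/(congr1 val)/= u0 /(congr1 val)/= u1] := valP u.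
  rewrite -mem_kerC xu (valP (val u)); split=> //.
    by apply/coset_eq1; rewrite -vquot_mapE xu.
  by apply/coset_eq1; rewrite -vquot_mapE xu.
apply: (@quotg_isomorphic _ _ _ _ T).
- move=> u w u' w' [x [xu x1 xw]] [x' [xu' x1' xw']]; exists (x * x').
  split; first by rewrite cosetM xu xu' gmulfM.
    by rewrite gmulfM x1 x1' mulg1.
  by rewrite (@gmulfM _ _ (face _)) (@gmulfM _ _ f) cosetM xw xw' -cosetM.
- move=> u w [x [xu x1 xw]]; exists x^-1; split.
    by rewrite cosetV xu homV.
    by rewrite homV x1 invg1.
  by rewrite (homV (face _)) (homV f) cosetV xw -cosetV.
- move=> u; pose x' := repr (v u).
  (* d_1 of [x'] is only verbal; a verbal degenerate factor makes it trivial without changing the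
     class. *)
  pose x := x' * (degen (inord 0) (face (inord 1) x'))^-1.
  have [_ Vx1' _] := uP u _ (coset_repr _).
  have xu : coset (verbal V _) x = v u.
    rewrite cosetM coset_repr cosetV.
    have /(verbal_hom (degen (inord 0)))/coset_eq1-> := Vx1'.
    by rewrite invg1 mulg1.
  have x1 : face (inord 1) x = 1.
    by rewrite gmulfM homV (@face_degen_succ A 0 _ 0) // mulgV.
  have [Vx0 _ Vax] := uP _ _ xu.
  have wP : f (face (inord 0) x) \in capg R (vstar V S).
    rewrite inE; apply/andP; split.
      by apply: fR; apply/boundaries0P; exists x.
    by apply: vstar_hom (face0_vstar x1 Vx0 Vax).
  by exists (mk_subg wP), x.
- move=> w; have /andP[wR wS] := valP w.
  have [x [x1 x0 Vax]] := vstar_lift_face0 (hR wR) (vstar_hom hS wS).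
  have Vx0 : face (inord 0) x \in verbal V (A 0%N).
    by rewrite x0; apply: verbal_hom; apply: vstar_verbal wS.
  pose c : C 1%N := mk_subg (etrans (mem_kerC x) Vax).
  have cP : c \in cycles C 1.
    apply/cycles1P; split; apply: val_inj; rewrite /= vquot_mapE;
      apply/coset_eq1 => //.
    by rewrite x1 gpred1.
  exists (mk_subg cP), x; split; rewrite ?vE //.
  (* d_0 x is [h w], and [f \o h] fixes the verbal element [w] modulo [R V* F]. *)
  rewrite x0; apply: (verbal_mod (f := f \o h) (g := idfun) hK).
  exact: vstar_verbal wS.
move=> u w [x [xu x1 xw]]; have [Vx0 _ Vax] := uP _ _ xu.
rewrite !mem_preimg /subg_val; apply/idP/idP.
  move=> /boundaries1P[y []].
  move=> /(congr1 val)/= y1 /(congr1 val)/= y2 /(congr1 val)/= y0.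
  move: y0 y1 y2; rewrite -(coset_repr (val y)) -vE -xu !vquot_mapE.
  move=> /esym/eq_coset y0 /coset_eq1 y1 /coset_eq1 y2.
  apply/coset_eq1; rewrite -xw; apply/coset_eq1/(vstar_hom fR).
  exact: boundary_face0 y0.
move=> /coset_eq1; rewrite -xw => /coset_eq1/(vstar_hom hR)/coset_eq1.
have /= -> := verbal_mod (f := h \o f) (g := idfun) fK Vx0.
move=> /coset_eq1/(face0_boundary x1 Vax)[y [y1 y2 ya y0]].
have yP : a 2%N y \in verbal V (B 2%N) by rewrite ya gpred1.
pose c : C 2%N := mk_subg (etrans (mem_kerC y) yP).
apply/boundaries1P; exists c; split; apply: val_inj;
  rewrite /= vquot_mapE ?y0 -?vE //.
- by rewrite y1 coset1.
- by rewrite y2 coset1.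
Qed.
End Presentation.
End SplitMap.

(** * Free resolutions and free presentations *)

(** Projectivity of free groups: [q] and [p \o l] agree on a basis. *)
Lemma free_lift (F E Q : groupType) (p : {multiplicative E -> Q})
    (q : {multiplicative F -> Q}) :
  is_free F -> (forall y, exists x, p x = y) ->
  exists l : {multiplicative F -> E}, forall x, p (l x) = q x.
Proof.
move=> [X bX] p_surj; have [t pt] := choice (fun x => p_surj (q x)).
have [l lX _] := bX E t; have [r _ r_uniq] := bX Q q.
exists l => x; rewrite (r_uniq q) // -(r_uniq (p \o l)) // => y /lX /= ->.
exact: pt.
Qed.

Lemma complement_section (G : groupType) (N : normalClosed G) :
  has_complement N ->
  exists s : {multiplicative quotg N -> G}, cancel s (coset N).
Proof.
move=> [H [HN1 HN]].
have lift u : exists h, h \in H /\ coset N h = u.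
  have [h [n [Hh Nn rE]]] := HN (repr u); exists h; split=> //.
  by rewrite -[u]coset_repr rE cosetM; move/coset_eq1: Nn => ->; rewrite mulg1.
have [s sP] := choice lift.
have sH u : s u \in H by case: (sP u).
have sK : cancel s (coset N) by move=> u; case: (sP u).
have sM : {morph s : u v / u * v}.
  (* The defect of multiplicativity lies in both [H] and [N]. *)
  move=> u v; apply/eqP; rewrite -divg_eq1; apply/eqP/HN1.
    by rewrite gpredM ?gpredV ?gpredM.
  by apply/coset_eq1; rewrite cosetM cosetV cosetM !sK mulgV.
pose ms := isMultiplicative.Build _ _ s sM.
pose s' : {multiplicative quotg N -> G} := HB.pack s ms.
by exists s'.
Qed.

Section Resolution.
Variables (K : free_resolution) (G : groupType).

Lemma resolution_aspherical x :
  x \in cycles (K G) 1 -> x \in boundaries (K G) 1.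
Proof.
move=> xZ.
pose B := preimg (@subg_val _ (cycles (K G) 1)) (boundaries (K G) 1).
pose u := coset B (mk_subg xZ).
by have /coset_eq1 := @res_acyclic K G 1 isT u.
Qed.

Definition augmentation (x : K G 0) : G := res_aug K G (pi0_class x).

Fact augmentation_morph : {morph augmentation : x y / x * y}.
Proof.
move=> x y; rewrite -gmulfM /pi0_class; congr (res_aug K G _).
by rewrite -cosetM; congr (coset _ _); apply: val_inj.
Qed.
HB.instance Definition _ :=
  isMultiplicative.Build (K G 0) G augmentation augmentation_morph.

Lemma augmentation_surj g : exists x, augmentation x = g.
Proof.
have [r _ rK] := res_aug_bij K G; exists (val (repr (r g))).
rewrite -[RHS]rK -[in RHS](coset_repr (r g)); congr (res_aug K G (coset _ _)).
exact: val_inj.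
Qed.

(** pi_0 is K_0 modulo boundaries, and [res_aug] is injective. *)
Lemma augmentation_ker x : (x \in boundaries (K G) 0) = (augmentation x == 1).
Proof.
have inj := bij_inj (res_aug_bij K G).
rewrite /augmentation -(hom1 (res_aug K G)) (inj_eq inj).
by apply/idP/eqP => [xB|/coset_eq1 //]; apply/coset_eq1.
Qed.

Lemma res0_free : is_free (K G 0).
Proof. by have [X [bX _]] := res_free K G; exists (X 0). Qed.
End Resolution.

Theorem corollary3p4 (V : set law) (K : free_resolution)
    (G : groupType) (N : normalClosed G)
    (hN : has_complement N)
    (F : groupType) (hF : is_free F) (R S : normalClosed F)
    (hRS : forall x, x \in R -> x \in S)
    (phi : {multiplicative quotg R -> G}) (hphi : bijective phi)
    (hphiS : forall x, (x \in S) = (phi (coset R x) \in N)) :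
  isomorphic (baer_invariant V K N)
             (subquot (capg R (vstar V S)) (vstar V R)).
Proof.
have [s sK] := complement_section hN.
pose p : {multiplicative F -> G} := phi \o coset R.
have phi_inj := bij_inj hphi.
have p_surj g : exists x, p x = g.
  by have [r _ rK] := hphi; exists (repr (r g)); rewrite /= coset_repr rK.
have pR x : (x \in R) = (p x == 1).
  by rewrite -(hom1 phi) (inj_eq phi_inj); apply/idP/eqP => /coset_eq1.
pose eps : {multiplicative K G 0 -> G} := @augmentation K G.
(* [f] and [h] lie over [G], so their composites are the identity modulo R_0 and [R]. *)
have [f pf] := free_lift eps (@res0_free K G) p_surj.
have [h eh] := free_lift p hF (@augmentation_surj K G).
(* Naturality of the augmentation identifies S_0 with the preimage of [N]. *)
have S0E x : (x \in preimg (res_map K (coset N) 0) (boundaries (K (quotg N)) 0))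
    = (eps x \in N).
  rewrite mem_preimg augmentation_ker /augmentation res_aug_nat.
  by apply/eqP/idP => /coset_eq1.
apply: (@baer_presentation _ _ _ _ (res_map K s) _ _ _ _ _ _ f h).
(* Functoriality turns the section [s] of G -> G/N into a splitting of the resolutions. *)
- move=> n x; rewrite -res_comp -[RHS](@res_id K (quotg N)).
  by congr (res_map K _ n x); apply: multiplicative_eq => u; apply: sK.
- exact: resolution_aspherical.
- exact: resolution_aspherical.
- by move=> x; rewrite augmentation_ker pR pf.
- by move=> x; rewrite S0E hphiS -[phi _]/(p (f x)) pf.
- by move=> x; rewrite augmentation_ker pR -[augmentation _]/(eps (h x)) eh.
- by move=> x; rewrite S0E hphiS eh.
- move=> x; apply/eq_coset; rewrite augmentation_ker -[augmentation _]/(eps _).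
  by rewrite gmulfM homV eh pf mulVg.
- by move=> x; apply/eq_coset; rewrite pR gmulfM homV pf eh mulVg.
Qed.
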